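(* Let $(\xi_n)_{n\in\mathbb{N}}\subset L^0_+$ be a sequence of nonnegative random variables on a probability space $(\Omega,\mathscr{F},\mathbb{P})$, let $(\xi_{n_k})_{k\in\mathbb{N}}$ be a subsequence and let $\xi:\Omega\to[0,\infty]$ be a nonnegative random variable such that (a) $(\xi_{n_k})_{k\in\mathbb{N}}$ is $\mathbb{P}$-almost surely Cesàro convergent to $\xi$; and (b) there exists an equivalent probability measure $\mathbb{Q}\approx\mathbb{P}$ such that the sequence $(\xi_{n_k}\mathbf{1}_{\{\xi<\infty\}})_{k\in\mathbb{N}}$ is $L^1(\mathbb{Q})$-bounded. Let $\bar\xi_{n_k}:=\frac1k\sum_{l=1}^k\xi_{n_l}$ for $k\in\mathbb{N}$, and let $$C:=\mathrm{conv}\{\xi_{n_k}:k\in\mathbb{N}\},\qquad \bar C:=\mathrm{conv}\{\bar\xi_{n_k}:k\in\mathbb{N}\}.$$ Let $\{\Omega_b,\Omega_u\}$ and $\{\bar\Omega_b,\bar\Omega_u\}$ be the decomposition partitions of $\Omega$ associated with the convex sets $C$ and $\bar C$, respectively. Then, up to $\mathbb{P}$-null sets, $$\{\xi<\infty\}=\Omega_b=\bar\Omega_b\quad\text{and}\quad\{\xi=\infty\}=\Omega_u=\bar\Omega_u .$$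
   Context: $L^0=L^0(\Omega,\mathscr{F},\mathbb{P})$ is the space of equivalence classes (modulo $\mathbb{P}$-almost sure equality) of real-valued random variables, and $L^0_+$ is the convex cone of all $X\in L^0$ with $\mathbb{P}(X\ge 0)=1$. A sequence $(X_k)_{k\in\mathbb{N}}\subset L^0_+$ is $\mathbb{P}$-almost surely Cesàro convergent to $X:\Omega\to[0,\infty]$ if $\frac1k\sum_{l=1}^k X_l\to X$ $\mathbb{P}$-almost surely in $[0,\infty]$. For a probability measure $\mathbb{Q}$ equivalent to $\mathbb{P}$ (written $\mathbb{Q}\approx\mathbb{P}$; same null sets), a set $K\subset L^0$ is $L^1(\mathbb{Q})$-bounded if $\sup_{X\in K}\mathbb{E}_{\mathbb{Q}}[|X|]<\infty$; a sequence is $L^1(\mathbb{Q})$-bounded if the set of its members is. A set $K\subset L^0$ is bounded in probability if for every $\epsilon>0$ there is $M>0$ with $\sup_{X\in K}\mathbb{P}(|X|>M)<\epsilon$. For $B\in\mathscr{F}$ write $K|_B:=\{X\mathbf{1}_B:X\in K\}$. A set $K\subset L^0$ is hereditarily unbounded in probability on $A\in\mathscr{F}$ if for every $B\in\mathscr{F}$ with $B\subset A$ and $\mathbb{P}(B)>0$ the set $K|_B$ is not bounded in probability. Decomposition (known lemma of Brannath and Schachermayer): for every convex $K\subset L^0_+$ there is a partition of $\Omega$ into disjoint sets $\Omega_u,\Omega_b\in\mathscr{F}$ (possibly empty), unique up to $\mathbb{P}$-null sets, such that $K|_{\Omega_b}$ is bounded in probability and $K$ is hereditarily unbounded in probability on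 $\Omega_u$. This is the decomposition partition associated with $K$. $\mathrm{conv}$ denotes the convex hull (finite convex combinations). *)

(* Defs.v *)
From HB Require Import structures.
From mathcomp Require Import all_boot all_order all_algebra.
From mathcomp Require Import all_classical all_reals all_analysis.
From mathcomp Require Import measurable_realfun.

Set Implicit Arguments.
Unset Strict Implicit.
Unset Printing Implicit Defensive.

Import Order.TTheory GRing.Theory Num.Theory.
Import numFieldNormedType.Exports.

Local Open Scope classical_set_scope.
Local Open Scope ring_scope.
Local Open Scope quotient_scope.

(* The library provides the quotient of the measurable functions by almost sure
   equality, but no algebraic structure on it; we equip it with its R-module
   structure. An element X : L0 P coerces to a chosen representative of its
   class. *)
Definition L0 d (T : measurableType d) (R : realType) (P : probability T R) :
  Type := {mfun_ P, T >-> R}.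

Section L0_lmodule.
Context d (T : measurableType d) (R : realType) (P : probability T R).

HB.instance Definition _ := Choice.on (L0 P).

Definition L0_class (f : {mfun T >-> R}) : L0 P := \pi_({mfun_ P, T >-> R}) f.

Definition L0_repr (X : L0 P) : {mfun T >-> R} := repr (X : {mfun_ P, T >-> R}).

Lemma L0_reprK : cancel L0_repr L0_class.
Proof. by move=> X; rewrite /L0_class /L0_repr reprK. Qed.

Lemma L0_classP (f g : {mfun T >-> R}) :
  L0_class f = L0_class g <-> f = g %[ae P].
Proof.
split.
  by move=> /eqP; rewrite /L0_class eqmodE => /asboolP.
by move=> fg; apply/eqP; rewrite /L0_class eqmodE; apply/asboolP.
Qed.

Lemma L0_repr_class (f : {mfun T >-> R}) : L0_repr (L0_class f) = f %[ae P].
Proof. by apply/L0_classP; rewrite L0_reprK. Qed.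

Definition L0_zero : L0 P := L0_class 0.
Definition L0_opp (X : L0 P) : L0 P := L0_class (- L0_repr X).
Definition L0_add (X Y : L0 P) : L0 P := L0_class (L0_repr X + L0_repr Y).
Definition L0_scale (a : R) (X : L0 P) : L0 P := L0_class (a *: L0_repr X).

Lemma L0_class_opp f : L0_opp (L0_class f) = L0_class (- f).
Proof.
apply/L0_classP; have := L0_repr_class f.
apply: filterS => w fw _; have e h : (- h : {mfun T >-> R}) w = - h w by [].
by rewrite !e fw.
Qed.

Lemma L0_class_add f g : L0_add (L0_class f) (L0_class g) = L0_class (f + g).
Proof.
apply/L0_classP; have := L0_repr_class g; have := L0_repr_class f.
apply: filterS2 => w fw gw _.
have e h k : (h + k : {mfun T >-> R}) w = h w + k w by [].
by rewrite !e fw // gw.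
Qed.

Lemma L0_class_scale a f : L0_scale a (L0_class f) = L0_class (a *: f).
Proof.
apply/L0_classP; have := L0_repr_class f.
apply: filterS => w fw _; have e h : (a *: h : {mfun T >-> R}) w = a * h w by [].
by rewrite !e fw.
Qed.

Let addA : associative L0_add.
Proof.
move=> X Y Z; rewrite -(L0_reprK X) -(L0_reprK Y) -(L0_reprK Z).
by rewrite !L0_class_add addrA.
Qed.

Let addC : commutative L0_add.
Proof. by move=> X Y; rewrite /L0_add addrC. Qed.

Let add0 : left_id L0_zero L0_add.
Proof. by move=> X; rewrite -(L0_reprK X) L0_class_add add0r. Qed.

Let addN : left_inverse L0_zero L0_opp L0_add.
Proof.
by move=> X; rewrite -(L0_reprK X) L0_class_opp L0_class_add addNr.
Qed.

HB.instance Definition _ := GRing.isZmodule.Build (L0 P) addA addC add0 addN.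

Let scaleA a b (X : L0 P) : L0_scale a (L0_scale b X) = L0_scale (a * b) X.
Proof. by rewrite -(L0_reprK X) !L0_class_scale scalerA. Qed.

Let scale1 : left_id 1 L0_scale.
Proof. by move=> X; rewrite -(L0_reprK X) L0_class_scale scale1r. Qed.

Let scaleDr : right_distributive L0_scale L0_add.
Proof.
move=> a X Y; rewrite -(L0_reprK X) -(L0_reprK Y).
by rewrite L0_class_add !L0_class_scale L0_class_add scalerDr.
Qed.

Let scaleDl (X : L0 P) : {morph L0_scale^~ X : a b / a + b >-> L0_add a b}.
Proof.
move=> a b; rewrite -(L0_reprK X).
by rewrite !L0_class_scale L0_class_add scalerDl.
Qed.

HB.instance Definition _ :=
  GRing.Zmodule_isLmodule.Build R (L0 P) scaleA scale1 scaleDr scaleDl.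

End L0_lmodule.

Coercion L0_repr : L0 >-> MeasurableFun.type.

Section module_notions.
Context (R : realType) (E : lmodType R).

Definition conv_hull (K : set E) : set E :=
  [set x | exists (m : nat) (c : 'I_m -> R) (y : 'I_m -> E),
    [/\ forall i, 0 <= c i, \sum_(i < m) c i = 1, forall i, K (y i)
      & x = \sum_(i < m) c i *: y i]].

(* Sequences are indexed from 0: [cesaro_mean X k] averages X 0, ..., X k. *)
Definition cesaro_mean (X : nat -> E) (k : nat) : E :=
  k.+1%:R^-1 *: \sum_(l < k.+1) X l.

End module_notions.

Section L0_notions.
Context d (T : measurableType d) (R : realType) (P : probability T R).
Implicit Types (X Y : L0 P) (K : set (L0 P)) (A B : set T).
Local Open Scope ereal_scope.

Definition L0_nonneg : set (L0 P) :=
  [set X : L0 P | P [set w | (0 <= X w)%R] = 1].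

(* K|_B, for measurable B: the a.e. equation determines the class of X 1_B. *)
Definition L0_restrict K B : set (L0 P) :=
  [set Y : L0 P | exists2 X, K X & Y = (fun w => (X w * \1_B w)%R) %[ae P]].

Definition ae_cesaro_cvg (X : nat -> L0 P) (xi : T -> \bar R) : Prop :=
  \forall w \ae P, ((cesaro_mean X k : L0 P) w)%:E @[k --> \oo] --> xi w.

Definition equivalent_probability (Q : probability T R) : Prop :=
  Q `<< P /\ P `<< Q.

(* Only meaningful for Q equivalent to P: otherwise E_Q[|X|] depends on the
   representative of X. *)
Definition L1_bounded (Q : probability T R) K : Prop :=
  ereal_sup [set 'E_Q[fun w => `|X w|%R] | X in K] < +oo.

Definition bounded_in_probability K : Prop :=
  forall e : R, (0 < e)%R -> exists2 M : R, (0 < M)%R &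
    ereal_sup [set P [set w | (M < `|X w|)%R] | X in K] < e%:E.

Definition hereditarily_unbounded K A : Prop :=
  forall B, measurable B -> B `<=` A -> 0 < P B ->
    ~ bounded_in_probability (L0_restrict K B).

Definition decomposition_partition K (Ob Ou : set T) : Prop :=
  [/\ measurable Ob /\ measurable Ou, Ob `&` Ou = set0, Ob `|` Ou = setT,
      bounded_in_probability (L0_restrict K Ob) & hereditarily_unbounded K Ou].

Definition eq_mod_null A B : Prop := P.-negligible (A `+` B).

End L0_notions.

(* Main.v *)
(* On {xi < oo} the functional X |-> E_Q[|X|; xi < oo] is convex, so its bound
   on the xi_(n_k) passes to their convex hull and to that of their Cesaro
   means; by Markov's inequality and the uniform absolute continuity of P with
   respect to Q, both hulls are bounded in probability there, which makes
   Ou `&` [xi < oo] null. Both hulls contain the Cesaro means, which diverge to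
   +oo almost surely on {xi = oo}; hence no non-null subset of {xi = oo} lies
   in Ob. *)
Require Import Defs.
From HB Require Import structures.
From mathcomp Require Import all_boot all_order all_algebra.
From mathcomp Require Import all_classical all_reals all_analysis.
From mathcomp Require Import measurable_realfun.

Set Implicit Arguments.
Unset Strict Implicit.
Unset Printing Implicit Defensive.

Import Order.TTheory GRing.Theory Num.Theory.
Import numFieldNormedType.Exports.

Local Open Scope classical_set_scope.
Local Open Scope ring_scope.

(** * Almost sure form of the operations on classes *)

Section L0_operations.
Context d (T : measurableType d) (R : realType) (P : probability T R).
Implicit Types X Y : L0 P.

Lemma L0_addE X Y : (X + Y : L0 P) = (fun w => X w + Y w) %[ae P].
Proof. exact: L0_repr_class (L0_repr X + L0_repr Y). Qed.

Lemma L0_scaleE a X : (a *: X : L0 P) = (fun w => a * X w) %[ae P].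
Proof. exact: L0_repr_class (a *: L0_repr X). Qed.

(** Members of K|_B are specified only by an a.e. equation; this supplies a class that solves it. *)
Lemma L0_indic X B : measurable B ->
  exists Y : L0 P, Y = (fun w => X w * \1_B w) %[ae P].
Proof.
move=> mB; pose h : {mfun T >-> R} := L0_repr X * mindic R mB.
exists (L0_class P h); exact: (L0_repr_class P h).
Qed.

End L0_operations.

(** * Convex hulls and Cesàro means *)

Section conv_hull_theory.
Context (R : realType) (E : lmodType R).

Lemma sub_conv_hull (K : set E) : K `<=` conv_hull K.
Proof.
move=> x Kx; exists 1%N, (fun=> 1), (fun=> x).
by split=> //; rewrite big_ord1// scale1r.
Qed.

Lemma conv_hull_mono (K L : set E) : K `<=` L -> conv_hull K `<=` conv_hull L.
Proof.
by move=> KL x [m [c [y [c0 c1 Ky ->]]]]; exists m, c, y; split=> // i; exact: KL.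
Qed.

Lemma cesaro_mean_conv_hull (X : nat -> E) k :
  conv_hull (range X) (cesaro_mean X k).
Proof.
exists k.+1, (fun=> k.+1%:R^-1), (X \o val); split=> //.
- by rewrite sumr_const card_ord -[LHS]mulr_natl divff.
- by rewrite /cesaro_mean scaler_sumr.
Qed.

End conv_hull_theory.

(** * Tail events and uniform absolute continuity *)

Lemma measurable_norm_gt d (T : measurableType d) (R : realType)
    (f : {mfun T >-> R}) (M : R) : measurable [set w | M < `|f w|].
Proof.
rewrite (_ : [set w | _] = (fun w => `|f w|) @^-1` `]M, +oo[%classic).
  rewrite -[X in measurable X]setTI.
  by apply: (@measurableT_comp _ _ _ _ _ _ (fun x : R => `|x|)) => //.
by apply/seteqP; split=> w /=; rewrite in_itv/= andbT.
Qed.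

(** Viewed as a finite charge, [P] has a total variation that dominates it and is continuous with
    respect to [Q]. *)
Lemma probability_null_dominates_continuous d (T : measurableType d)
    (R : realType) (P Q : probability T R) : P `<< Q ->
  forall e : R, 0 < e -> exists2 r : R, 0 < r &
  forall A, measurable A -> (Q A < r%:E -> P A < e%:E)%E.
Proof.
move=> PQ e e0.
have [A [N nuAN]] := Hahn_decomposition (charge_of_finite_measure P).
have [r [r0 h]] := charge_variation_continuous nuAN PQ e0.
exists r => // B mB /(h _ mB); apply: le_lt_trans.
exact: le_trans (lee_abs _) (abse_charge_variation nuAN mB).
Qed.

(** * From integral bounds under [Q] to boundedness in probability under [P] *)

Section integral_bound.
Context d (T : measurableType d) (R : realType) (P Q : probability T R).
Context (F : set T) (mF : measurable F) (QP : Q `<< P).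
Implicit Types X Y : L0 P.
Local Open Scope ereal_scope.

Definition integral_abs X : \bar R := \int[Q]_(w in F) (`|X w|%R)%:E.

Let mabs (f : {mfun T >-> R}) : measurable_fun F (fun w => (`|f w|%R)%:E).
Proof.
by apply/measurable_EFinP; apply: measurableT_comp => //; exact: measurable_funTS.
Qed.

Lemma integral_absD X Y :
  integral_abs (X + Y)%R <= integral_abs X + integral_abs Y.
Proof.
rewrite -ge0_integralD//.
apply: ae_ge0_le_integral => //.
- by move=> w _; rewrite adde_ge0.
- by apply: emeasurable_funD; exact: mabs.
have := null_dominates_ae_eq measurableT QP (L0_addE X Y).
by apply: filterS => w /(_ I) /= -> _; rewrite -EFinD lee_fin ler_normD.
Qed.

Lemma integral_absZ a X : integral_abs (a *: X)%R = (`|a|%R)%:E * integral_abs X.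
Proof.
rewrite -ge0_integralZl_EFin//.
apply: ge0_ae_eq_integral => //.
- by apply: measurable_funeM; exact: mabs.
have := null_dominates_ae_eq measurableT QP (L0_scaleE a X).
by apply: filterS => w /(_ I) /= -> _; rewrite -EFinM normrM.
Qed.

Lemma conv_hull_integral_abs_le (K : set (L0 P)) (S : \bar R) :
  (forall X, K X -> integral_abs X <= S) ->
  forall X, conv_hull K X -> integral_abs X <= S.
Proof.
move=> KS _ [m [c [y [c0 c1 Ky ->]]]].
apply: (@le_trans _ _ (\sum_(i < m) (c i)%:E * integral_abs (y i))).
  elim/big_ind2 : _ => [|x1 x2 y1 y2 h1 h2|i _].
  (* The representative of the zero class vanishes only almost surely, so zero is written as a
     multiple and homogeneity applies. *)
  - by rewrite -(scale0r (0%R : L0 P)) integral_absZ normr0 mul0e.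
  - by rewrite (le_trans (integral_absD _ _))// leeD.
  - by rewrite integral_absZ ger0_norm.
apply: (@le_trans _ _ (\sum_(i < m) (c i)%:E * S)).
  by apply: lee_sum => i _; rewrite lee_wpmul2l ?lee_fin ?KS.
by rewrite -ge0_sume_distrl ?sumEFin ?c1 ?mul1e// => i _; rewrite lee_fin.
Qed.

Lemma integral_abs_indic X Y B : measurable B ->
  Y = (fun w => X w * \1_B w)%R %[ae P] ->
  \int[Q]_w (`|Y w|%R)%:E = \int[Q]_(w in B) (`|X w|%R)%:E.
Proof.
move=> mB YX; rewrite [RHS]integral_mkcond; apply: ge0_ae_eq_integral => //.
- by apply/measurable_EFinP; exact: measurableT_comp.
- apply/(measurable_restrictT _ _).1 => //.
  by apply/measurable_EFinP; apply: measurableT_comp => //; exact: measurable_funTS.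
- by move=> w _; rewrite erestrict_ge0.
have := null_dominates_ae_eq measurableT QP YX.
apply: filterS => w /(_ I) /= -> _; rewrite patchE indicE.
by case: ifPn => /= _; rewrite ?mulr1// mulr0 normr0.
Qed.

Lemma L1_bounded_integral_abs (K : set (L0 P)) :
  L1_bounded Q (L0_restrict K F) ->
  exists2 s : R, (0 < s)%R & forall X, K X -> integral_abs X <= s%:E.
Proof.
rewrite /L1_bounded; set S := ereal_sup _ => Soo.
have [s s0 Ss] : exists2 s : R, (0 < s)%R & S <= s%:E.
  (* The supremum is -oo when [K] is empty. The bound is kept positive because it later serves to
     build a positive threshold. *)
  case: (S) Soo => [r _||_]//; last by exists 1%R; rewrite ?leNye.
  by exists (Num.max 1%R r); rewrite ?lt_max ?ltr01// lee_fin le_max lexx orbT.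
exists s => // X KX; apply: le_trans Ss.
have [Y YX] := L0_indic X mF.
rewrite /integral_abs -(integral_abs_indic mF YX).
by apply: ereal_sup_ubound; exists Y; [exists X|rewrite unlock].
Qed.

Lemma bounded_in_probability_restrict (K : set (L0 P)) (s : R) (B : set T) :
  P `<< Q -> (0 < s)%R -> measurable B -> B `<=` F ->
  (forall X, K X -> integral_abs X <= s%:E) ->
  bounded_in_probability (L0_restrict K B).
Proof.
move=> PQ s0 mB BF Ks e e0.
have e20 : (0 < e / 2)%R by rewrite divr_gt0.
have [r r0 hr] := probability_null_dominates_continuous PQ e20.
(* Markov then gives a [Q]-tail of at most s / M = r / 2 < r, uniformly in [K]. The tolerance e / 2
   keeps the final inequality strict after the supremum. *)
pose M := (2 * s / r)%R; have M0 : (0 < M)%R by rewrite !mulr_gt0 ?invr_gt0.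
exists M => //; apply: (@le_lt_trans _ _ (e / 2)%:E); last first.
  by rewrite lte_fin gtr_pMr// invf_lt1// ltr1n.
apply: ge_ereal_sup => _ [Y [X KX YX] <-]; apply: ltW; apply: hr.
  exact: measurable_norm_gt.
apply: (@le_lt_trans _ _ (r / 2)%:E); last first.
  by rewrite lte_fin gtr_pMr// invf_lt1// ltr1n.
have mY : measurable_fun setT (fun w => (Y w)%:E) by exact/measurable_EFinP.
have markovY : M%:E * Q [set w | (M < `|Y w|)%R] <= s%:E.
  have h := @le_integral_comp_abse _ _ _ Q _ measurableT _ M id
    (@measurable_id _ _ setT) (fun _ h => h) (fun _ _ _ _ h => h) mY M0.
  (* Markov's inequality concerns the non-strict tail, which contains the strict one. *)
  apply: (@le_trans _ _ (M%:E * Q (setT `&` [set w | M%:E <= `|(Y w)%:E|]))).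
    apply: lee_wpmul2l; first by rewrite lee_fin ltW.
    apply: le_measure; rewrite ?inE; first exact: measurable_norm_gt.
    - apply: emeasurable_fun_c_infty => //; exact: measurableT_comp.
    - by move=> w /= /ltW MY; split=> //; rewrite /= lee_fin.
  apply: (le_trans h); apply: le_trans (Ks X KX).
  rewrite /= (integral_abs_indic mB YX).
  by apply: ge0_subset_integral => //; exact: mabs.
have QE : Q [set w | (M < `|Y w|)%R] = (fine (Q [set w | (M < `|Y w|)%R]))%:E.
  by rewrite fineK// fin_num_measure//; exact: measurable_norm_gt.
move: markovY; rewrite QE -EFinM !lee_fin mulrC -ler_pdivlMr// => /le_trans; apply.
by rewrite /M invfM invrK mulrA invfM mulrCA divff ?gt_eqF// mulr1 mulrC.
Qed.

End integral_bound.

(** * Divergence on {xi = oo} and comparison of the partitions *)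

Lemma measure_eq0_of_cvg_pinfty d (T : measurableType d) (R : realType)
    (P : probability T R) (K : set (L0 P)) (X : nat -> L0 P) (A B : set T) :
  (forall k, K (X k)) -> bounded_in_probability (L0_restrict K A) ->
  measurable A -> measurable B -> B `<=` A ->
  (\forall w \ae P, B w -> (X k w)%:E @[k --> \oo] --> +oo%E) -> P B = 0%E.
Proof.
move=> KX bK mA mB BA Xoo; apply/eqP; rewrite eq_le measure_ge0 andbT leNgt.
apply/negP => PB0.
have PBE : P B = (fine (P B))%:E by rewrite fineK// fin_num_measure.
(* With tolerance P(B), all tails above [M] have probability uniformly below P(B), while divergence
   puts almost every point of [B] in all late tails. *)
have /bK[M M0 supM] : 0 < fine (P B) by rewrite -lte_fin -PBE.
have /choice[Y YX] : forall k, exists Y : L0 P,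
  Y = (fun w => X k w * \1_A w) %[ae P] by move=> k; exact: L0_indic.
pose D k := [set w | M < `|Y k w|].
have mD k : measurable (D k) by exact: measurable_norm_gt.
(* The union of the increasing sets [G n] is the limit inferior of the tails. Since [G n] lies in
   [D n], continuity from below bounds its probability. *)
pose G n := \bigcap_(k in [set k | (n <= k)%N]) D k.
have mG n : measurable (G n) by apply: bigcap_measurable => //; exists n => /=.
have mUG : measurable (\bigcup_n G n) by exact: bigcupT_measurable.
have PUG : (P (\bigcup_n G n) < P B)%E.
  rewrite PBE; apply: le_lt_trans supM.
  have ndG : {homo G : n m / (n <= m)%N >-> (n <= m)%O}.
    move=> n m nm; apply/subsetPset => w Gw k /= mk; apply: Gw => /=.
    exact: leq_trans mk.
  have cvgG := nondecreasing_cvg_mu (mu := P) mG mUG ndG.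
  rewrite -(cvg_lim _ cvgG)//; apply: lime_le.
    by apply/cvg_ex; eexists; exact: cvgG.
  apply: nearW => n; apply: (@le_trans _ _ (P (D n))).
    by apply: le_measure; rewrite ?inE//; move=> w; apply => /=.
  by apply: ereal_sup_ubound; exists (Y n) => //; exists (X n).
have BUG : P (B `\` \bigcup_n G n) = 0%E.
  apply: measure_negligible; first exact: measurableD.
  have YX' : \forall w \ae P, forall k, Y k w = X k w * \1_A w.
    by apply: ae_foralln => k; have := YX k; apply: filterS => w /(_ I).
  have [N [mN N0 subN]] := filterI YX' Xoo; exists N; split=> // w [Bw nG].
  apply: subN => -[/= Yw /(_ Bw) Xw].
  apply: nG; move/cvgeyPgt : Xw => /(_ M)[n _ nM]; exists n => // k /= nk.
  rewrite /D /= Yw indicE mem_set ?mulr1; last exact: BA.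
  by have := nM k nk; rewrite lte_fin => /lt_le_trans; apply; exact: ler_norm.
move: PUG; apply/negP; rewrite -leNgt.
rewrite (measureDI P mB mUG) [X in (X + _)%E]BUG add0e.
by apply: le_measure; rewrite ?inE//; exact: measurableI.
Qed.

(** The iterated hull treats [C] and [Cbar] at once: [Cbar] is a hull of points that already lie in
    a hull, and the integral bound passes through each layer. *)
Lemma decomposition_partition_ae d (T : measurableType d) (R : realType)
    (P Q : probability T R) (X : nat -> L0 P) (K : set (L0 P))
    (xi : {RV P >-> \bar R}) (Ob Ou : set T) :
  ae_cesaro_cvg X xi -> equivalent_probability P Q ->
  L1_bounded Q (L0_restrict (range X) [set w | (xi w < +oo)%E]) ->
  K `<=` conv_hull (conv_hull (range X)) -> (forall k, K (cesaro_mean X k)) ->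
  decomposition_partition K Ob Ou ->
  P.-negligible ((Ou `&` [set w | (xi w < +oo)%E])
                 `|` (Ob `&` [set w | xi w = +oo%E])).
Proof.
move=> Xxi [QP PQ] L1X KX mK [[mOb mOu] _ _ bOb uOu].
have mF : measurable [set w | (xi w < +oo)%E].
  by rewrite -[X in measurable X]setTI; exact: emeasurable_fun_infty_o.
have mI : measurable [set w | xi w = +oo%E].
  rewrite -[X in measurable X]setTI.
  exact: (measurable_funPT xi) measurableT _ (emeasurable_set1 _).
apply: negligibleU; apply/negligibleP; try exact: measurableI.
- have [s s0 Xs] := L1_bounded_integral_abs mF QP L1X.
  (* Were this set non-null, hereditary unboundedness would contradict the boundedness that follows
     from the integral bound. *)
  apply/eqP; rewrite eq_le measure_ge0 andbT leNgt; apply/negP.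
  move=> /(uOu _ (measurableI _ _ mOu mF) (@subIsetl _ _ _)); apply.
  apply: (bounded_in_probability_restrict mF QP PQ s0) => //.
  + exact: measurableI.
  + by move=> Y /KX; do 2 apply: (conv_hull_integral_abs_le mF QP) => //.
- apply: (measure_eq0_of_cvg_pinfty mK bOb) => //; first exact: measurableI.
  by apply: filterS Xxi => w /[swap] -[_ /= ->].
Qed.

Theorem proposition1p2 (d : measure_display) (T : measurableType d)
    (R : realType) (P : probability T R)
    (xi_ : nat -> L0 P) (n : nat -> nat) (xi : {RV P >-> \bar R}) :
  (forall m, L0_nonneg (xi_ m)) ->
  {homo n : i j / (i < j)%N} ->
  (forall w, (0 <= xi w)%E) ->
  ae_cesaro_cvg (xi_ \o n) xi ->
  (exists Q : probability T R, equivalent_probability P Q /\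
    L1_bounded Q (L0_restrict (range (xi_ \o n)) [set w | (xi w < +oo)%E])) ->
  let C := conv_hull (range (xi_ \o n)) in
  let Cbar := conv_hull (range (cesaro_mean (xi_ \o n))) in
  forall Ob Ou Obbar Oubar : set T,
    decomposition_partition C Ob Ou ->
    decomposition_partition Cbar Obbar Oubar ->
    [/\ eq_mod_null P [set w | (xi w < +oo)%E] Ob,
        eq_mod_null P Ob Obbar,
        eq_mod_null P [set w | xi w = +oo%E] Ou
      & eq_mod_null P Ou Oubar].
Proof.
move=> _ _ _ Xxi [Q [PQ L1X]] C Cbar Ob Ou Obbar Oubar CO CbarO.
have NO := decomposition_partition_ae Xxi PQ L1X (@sub_conv_hull _ _ _)
  (cesaro_mean_conv_hull _) CO.
have NObar : P.-negligible ((Oubar `&` [set w | (xi w < +oo)%E])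
                 `|` (Obbar `&` [set w | xi w = +oo%E])).
  apply: (decomposition_partition_ae Xxi PQ L1X _ _ CbarO).
  - apply: conv_hull_mono => _ [k _ <-]; exact: cesaro_mean_conv_hull.
  - by move=> k; apply: sub_conv_hull; exists k.
move: CO CbarO => [_ OI OU _ _] [_ OIbar OUbar _ _].
have xiE w : (xi w < +oo)%E \/ xi w = +oo%E.
  by case: (xi w) => [r||]; [left; rewrite ltry|right|left].
have xiN w : (xi w < +oo)%E -> xi w = +oo%E -> False by move=> /[swap] ->.
have OE w : Ob w \/ Ou w by have : setT w by []; rewrite -OU.
have ON w : Ob w -> Ou w -> False.
  by move=> ? ?; have : (Ob `&` Ou) w by []; rewrite OI.
have ObarE w : Obbar w \/ Oubar w by have : setT w by []; rewrite -OUbar.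
have ObarN w : Obbar w -> Oubar w -> False.
  by move=> ? ?; have : (Obbar `&` Oubar) w by []; rewrite OIbar.
(* This one null set contains all four symmetric differences: off it, finiteness of [xi] decides
   membership in both partitions, so only propositional reasoning remains. *)
have NN := negligibleU NO NObar.
split; (apply: negligibleS NN => w /=);
  have := xiE w; have := @xiN w; have := OE w; have := @ON w;
  have := ObarE w; have := @ObarN w; rewrite /setY /setD /setU /setI /=; tauto.
Qed.
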